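(* If $T$ is an almost-Suslin tree, then $\diamondsuit_T$ holds if and only if $\diamondsuit$ holds.
   Context: A tree is a partial order $(T,<_T)$ in which the set of predecessors of each node is well-ordered; every tree is assumed to have a root, denoted $\emptyset$. For $t\in T$, $t{\downarrow}=\{s\in T\mid s<_T t\}$, $\mathrm{ht}(t)$ is the order type of $t{\downarrow}$, and $T_\alpha$ is the set of nodes of height $\alpha$. The height of $T$ is the least $\alpha$ with $T_\alpha=\emptyset$. An $\omega_1$-tree is a tree of height $\omega_1$ all of whose levels $T_\alpha$ are countable. An antichain is a set of pairwise incomparable nodes. An $\omega_1$-tree $T$ is almost-Suslin if for every antichain $A\subseteq T$ the set $\{\mathrm{ht}(t)\mid t\in A\}$ is nonstationary in $\omega_1$. A set $U\subseteq T$ is special if it is a union of at most countably many antichains; otherwise it is nonspecial. For $X\subseteq T$, a map $f:X\to T$ is regressive if $f(t)<_T t$ for all $t\in X\setminus\{\emptyset\}$. For $T$ of height $\omega_1$, $NS^T$ is the ideal of all $B\subseteq T$ for which there is a regressive $f:B\to T$ such that $f^{-1}(\{t\})$ is special for every $t\in T$. For a nonspecial tree $T$ of height $\omega_1$, $\diamondsuit_T$ asserts that there is a sequence $(D_t\mid t\in T)$ with $D_t\subseteq t{\downarrow}$ for all $t\in T$ such that for every $X\subseteq T$, $\{t\in T\mid X\cap t{\downarrow}=D_t\}\notin NS^T$. $\diamondsuit$ is Jensen's principle: there is $(D_\alpha)_{\alpha<\omega_1}$ with $D_\alpha\subseteq\alpha$ such that for every $X\subseteq\omega_1$ the set $\{\alpha<\omega_1\mid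 X\cap\alpha=D_\alpha\}$ is stationary. *)

(* Defs.v *)
From mathcomp Require Import all_boot all_order all_classical wochoice.

Set Implicit Arguments.
Unset Strict Implicit.
Unset Printing Implicit Defensive.

Import Order.TTheory.
Local Open Scope classical_set_scope.

Definition down d (S : porderType d) (s : S) : set S := [set r | (r < s)%O].

Definition order_iso d1 d2 (S1 : porderType d1) (S2 : porderType d2)
    (A : set S1) (B : set S2) : Prop :=
  exists2 f : S1 -> S2, set_bij A B f & {in A &, {mono f : x y / (x < y)%O}}.

(** omega_1 is handled up to isomorphism: W is a well-order of type omega_1,
    the least uncountable order type, and the countable ordinal a < omega_1 is
    represented by a : W, whose set of predecessors is down a. *)
Definition is_omega1 d (W : orderType d) : Prop :=
  [/\ well_order (<=%O : rel W),
      ~ countable [set: W] &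
      forall a : W, countable (down a)].

(** Clubs: unbounded, and containing every limit a of elements of C (the first
    premise excludes the case where a is the least element). *)
Definition club d (W : orderType d) (C : set W) : Prop :=
  (forall a : W, exists2 c, C c & (a < c)%O) /\
  (forall a : W, down a !=set0 ->
     (forall b, (b < a)%O -> exists2 c, C c & (b < c < a)%O) -> C a).

Definition stationary d (W : orderType d) (S : set W) : Prop :=
  forall C, club C -> S `&` C !=set0.

(** Jensen's principle, on a well-order W of type omega_1. *)
Definition diamond d (W : orderType d) : Prop :=
  exists D : W -> set W,
    (forall a, D a `<=` down a) /\
    (forall X : set W, stationary [set a | X `&` down a = D a]).

(** The root is the bottom element of the bPOrderType. *)
Definition is_tree d (T : bPOrderType d) : Prop :=
  forall t : T, wo_chain (<=%O : rel T) (mem (down t)).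

(** ht(t) = a for a countable ordinal a. *)
Definition has_height d1 d2 (W : orderType d1) (T : bPOrderType d2)
    (t : T) (a : W) : Prop :=
  order_iso (down t) (down a).

Definition level d1 d2 (W : orderType d1) (T : bPOrderType d2) (a : W) :
    set T :=
  [set t | has_height t a].
Arguments level {d1 d2 W} T a.

(** omega_1 is the least ordinal a with T_a empty; the second conjunct says
    that no node has height omega_1. *)
Definition height_omega1 d1 d2 (W : orderType d1) (T : bPOrderType d2) : Prop :=
  (forall a : W, level T a !=set0) /\
  (forall t : T, ~ order_iso (down t) [set: W]).

Definition omega1_tree d1 d2 (W : orderType d1) (T : bPOrderType d2) : Prop :=
  [/\ is_tree T, height_omega1 W T & forall a : W, countable (level T a)].

Definition antichain d (T : porderType d) (A : set T) : Prop :=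
  forall s t, A s -> A t -> s != t -> (s >< t)%O.

Definition almost_Suslin d1 d2 (W : orderType d1) (T : bPOrderType d2) : Prop :=
  omega1_tree W T /\
  forall A : set T, antichain A ->
    ~ stationary [set a : W | exists2 t, A t & has_height t a].

Definition special d (T : porderType d) (U : set T) : Prop :=
  exists2 F : set (set T),
    countable F /\ (forall A, F A -> antichain A) & U = \bigcup_(A in F) A.

(** Only the values of f on X matter: total functions replace f : X -> T. *)
Definition regressive d (T : bPOrderType d) (X : set T) (f : T -> T) : Prop :=
  forall t, X t -> t != \bot%O -> (f t < t)%O.

Definition NS_tree d (T : bPOrderType d) (B : set T) : Prop :=
  exists2 f : T -> T, regressive B f &
    forall t, special (B `&` f @^-1` [set t]).

Definition diamond_tree d (T : bPOrderType d) : Prop :=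
  exists D : T -> set T,
    (forall t, D t `<=` down t) /\
    (forall X : set T, ~ NS_tree [set t | X `&` down t = D t]).

(* Main.v *)
(** If [diamond W] holds, inject [T] into [W]: a guess at [a] yields a guess
    along every [t] of height [a], provided [a] lies in a suitable club. The
    nodes whose heights lie in a stationary set are not in the ideal, because a
    regressive map on them with special fibres would, after a diagonal
    intersection, contradict that heights of antichains are nonstationary.

    Conversely, a guess along [t] of a set of nodes determined by heights is a
    guess at [ht t]; the nodes with height off a club form a set in the ideal,
    so some guess is correct at a height in any given club. As levels are
    countable, each ordinal carries countably many guesses, and Kunen's
    argument extracts a diamond sequence from them. *)

Require Import Defs.
From mathcomp Require Import all_boot all_order all_classical wochoice.

Set Implicit Arguments.
Unset Strict Implicit.
Unset Printing Implicit Defensive.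

Import Order.TTheory Defs.
Local Open Scope classical_set_scope.

(** * Well-orders of type omega_1 and their clubs *)

Lemma well_order_min d (W : orderType d) (A : set W) :
  well_order (<=%O : rel W) -> A !=set0 ->
  exists2 m, A m & forall x, A x -> (m <= x)%O.
Proof.
move=> wo [x Ax]; have [|m [[Am lbm] _]] := wo (mem A).
  by exists x; apply: mem_set.
by exists m => [|y Ay]; [apply: set_mem | apply: lbm; apply: mem_set].
Qed.

Lemma well_order_wf d (W : orderType d) :
  well_order (<=%O : rel W) -> well_founded (fun x y : W => (x < y)%O).
Proof.
move=> wo x; apply: contrapT => nx.
have [|m nm mP] :=
  @well_order_min _ W [set y | ~ Acc (fun x y : W => (x < y)%O) y] wo.
  by exists x.
apply: nm; constructor => y ym; apply: contrapT => /mP.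
by rewrite leNgt ym.
Qed.

Lemma countableU (T : Type) (A B : set T) :
  countable A -> countable B -> countable (A `|` B).
Proof.
move=> cA cB; rewrite -bigcup2E; apply: bigcup_countable => // -[|[|i]] _ //=.
Qed.

Lemma omega1_countable_le d (W : orderType d) (a : W) :
  is_omega1 W -> countable [set b : W | (b <= a)%O].
Proof.
move=> [_ _ Wc]; have -> : [set b : W | (b <= a)%O] = [set a] `|` down a.
  apply/seteqP; split=> b /=; last by move=> [->|/ltW].
  by rewrite le_eqVlt => /orP[/eqP|]; [left | right].
exact: countableU.
Qed.

(** Otherwise the initial segments up to the elements of [A], countably many and each countable,
    would cover [W]. *)
Lemma omega1_bound d (W : orderType d) (A : set W) :
  is_omega1 W -> countable A -> exists b, forall x, A x -> (x < b)%O.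
Proof.
move=> W1 Ac; have [_ Wunc _] := W1; apply: contrapT => nb; apply: Wunc.
suff : countable (\bigcup_(x in A) [set b | (b <= x)%O]).
  apply: sub_countable; apply: subset_card_le => b _.
  have /existsNP[x /not_implyP[Ax /negP]] : ~ forall x, A x -> (x < b)%O.
    by move=> Ab; apply: nb; exists b.
  by rewrite -leNgt => bx; exists x.
by apply: bigcup_countable => // x _; exact: omega1_countable_le.
Qed.

(** The least element is excluded: it is vacuously closed under any map. *)
Definition closure_points d (W : orderType d) (h : W -> W) : set W :=
  [set a | down a !=set0 /\ forall b, (b < a)%O -> (h b < a)%O].

Lemma closure_points_max d (W : orderType d) (h k : W -> W) (a : W) :
  closure_points (fun x => Order.max (h x) (k x)) a ->
  closure_points h a /\ closure_points k a.
Proof. by move=> [a0 hk]; split; split=> // b /hk; rewrite gt_max => /andP[]. Qed.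

Lemma club_closure_points d (W : orderType d) (h : W -> W) :
  is_omega1 W -> club (closure_points h).
Proof.
move=> W1; have [wo _ _] := W1; split; last first.
  move=> a a0 lima; split=> // b /lima[c [_ hc] /andP[bc ca]].
  exact: lt_trans (hc _ bc) ca.
move=> a.
have /choice[g gP] x : exists b, forall y, (y <= x)%O -> (y < b)%O /\ (h y < b)%O.
  have cx := omega1_countable_le x W1; set A := [set _ | _] in cx.
  have [|b bP] := @omega1_bound _ W (A `|` h @` A) W1.
    by apply: countableU => //; exact: sub_countable (card_image_le _ _) cx.
  exists b => y yx; split; apply: bP; first by left.
  by right; exists y.
pose s n := iter n g a.
have sS n : (s n < s n.+1)%O by exact: (gP (s n) (s n) (lexx _)).1.
(* The iterates increase strictly, so their least strict upper bound [m] is their supremum. *)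
have [|m mP mmin] := @well_order_min _ W [set b | forall n, (s n < b)%O] wo.
  have [|b bP] := @omega1_bound _ W (range s) W1.
    exact: sub_countable (card_image_le _ _) _.
  by exists b => n; apply: bP; exists n.
exists m; last exact: (mP 0).
split; first by exists a; exact: (mP 0).
move=> b bm; have [n bn] : exists n, (b <= s n)%O.
  apply: contrapT => nb; suff /mmin : forall n, (s n < b)%O by rewrite leNgt bm.
  by move=> n; rewrite ltNge; apply/negP => bn; apply: nb; exists n.
exact: lt_trans (gP _ _ bn).2 (mP n.+1).
Qed.

(** A form of diagonal intersection: [h x] lies above a chosen next element, past each [y <= x], of
    every club with index at most [x]. A closure point of [h] is therefore a limit of every club of
    smaller index. *)
Lemma diagonal_closure_points d (W : orderType d) (Cs : W -> set (set W)) :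
  is_omega1 W -> (forall b, countable (Cs b)) ->
  (forall b C, Cs b C -> club C) ->
  exists h, forall a, closure_points h a ->
    forall b C, (b < a)%O -> Cs b C -> C a.
Proof.
move=> W1 Csc Csclub.
have ctle x := omega1_countable_le x W1.
have /choice[c cP] (p : set W * W) : exists b, club p.1 -> p.1 b /\ (p.2 < b)%O.
  move: p => [C x]; have [[Cunb _]|nC] := pselect (club C); last by exists x.
  by have [y Cy xy] := Cunb x; exists y.
have /choice[h hP] x : exists z, forall b C y, (b <= x)%O -> (y <= x)%O ->
    Cs b C -> (c (C, y) < z)%O.
  have [|z zP] := @omega1_bound _ W
      (c @` ((\bigcup_(b in [set b | (b <= x)%O]) Cs b) `*` [set y | (y <= x)%O])) W1.
    apply: sub_countable (card_image_le _ _) _; apply: countableX => //.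
    by apply: bigcup_countable.
  by exists z => b C y bx yx bC; apply: zP; exists (C, y) => //; split=> //; exists b.
exists h => a [a0 ha] b C ba bC; apply: (Csclub _ _ bC).2 => // y ya.
have [Cc yc] := cP (C, y) (Csclub _ _ bC).
exists (c (C, y)) => //; rewrite yc.
(* The maximum serves as the argument of [h], since it bounds both the index [b] and the point
   [y]. *)
have mxa : (Order.max b y < a)%O by rewrite gt_max ba.
by apply: lt_trans (ha _ mxa); apply: (hP _ b); rewrite ?le_max ?lexx ?orbT.
Qed.

Lemma not_stationary d (W : orderType d) (S : set W) :
  ~ stationary S -> exists2 C, club C & forall a, C a -> ~ S a.
Proof.
move=> nS; apply: contrapT => nC; apply: nS => C clubC; apply: contrapT => SC.
by apply: nC; exists C => // a Ca Sa; apply: SC; exists a.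
Qed.

(** * Injections into omega_1 *)

(** Recursion along [R] gives each element a value outside the countable set of values of its
    predecessors; totality then separates any two elements. *)
Lemma omega1_inj d (W : orderType d) (X : Type) (R : X -> X -> Prop) :
  is_omega1 W -> well_founded R -> (forall x y, x = y \/ R x y \/ R y x) ->
  (forall x, countable [set y | R y x]) -> exists e : X -> W, injective e.
Proof.
move=> W1 Rwf Rtot Rc.
have /choice[pick pickP] (A : set W) : exists b, countable A -> ~ A b.
  have [Ac|nA] := pselect (countable A).
    have [b bP] := omega1_bound W1 Ac.
    by exists b => _ /bP; rewrite ltxx.
  by have [b _] := omega1_bound W1 (@countable0 W); exists b.
pose F x (f : forall y, R y x -> W) : W :=
  pick [set b | exists y (p : R y x), f y p = b].
pose e := Fix Rwf (fun _ => W) F.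
have eE x : e x = pick (e @` [set y | R y x]).
  rewrite /e Fix_eq; last first.
    by move=> y f g fg; congr pick; apply/seteqP; split=> b [z [p <-]];
      exists z, p; rewrite fg.
  congr pick; apply/seteqP; split=> b; first by move=> [y [p <-]]; exists y.
  by move=> [y p <-]; exists y, p.
have neq x y : R y x -> e y <> e x.
  move=> yx; rewrite [in RHS]eE => eyx.
  apply: (pickP (e @` [set y | R y x])); first exact: sub_countable (card_image_le _ _) _.
  by rewrite -eyx; exists y.
exists e => x y exy; have [//|[/neq|/neq]] := Rtot x y; first by rewrite exy.
by rewrite exy.
Qed.

(** The lexicographic order has countable initial segments. The pairs will be a height with an index
    inside its level, or an ordinal with the number of a guess. *)
Lemma omega1_pairing d (W : orderType d) :
  is_omega1 W -> exists g : W * nat -> W, injective g.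
Proof.
move=> W1; have [wo _ Wc] := W1.
pose R (p q : W * nat) := (p.1 < q.1)%O \/ p.1 = q.1 /\ p.2 < q.2.
have Rwf : well_founded R.
  move=> [a n]; elim/(well_founded_ind (well_order_wf wo)): a n => a IHa n.
  elim/ltn_ind: n => n IHn; constructor=> -[b m] [/= ba|[/= -> mn]].
    exact: IHa.
  exact: IHn.
have Rtot p q : p = q \/ R p q \/ R q p.
  move: p q => [a n] [b m]; rewrite /R /=.
  case: (ltgtP a b) => [||->]; [by right; left; left | by right; right; left |].
  case: (ltngtP n m) => [||->]; [by right; left; right | by right; right; right |].
  by left.
apply: (omega1_inj W1 Rwf Rtot) => -[a n].
apply: (@sub_countable _ _ _ (down a `*` setT `|` [set a] `*` setT)).
  apply: subset_card_le => -[b m] [/= ba|[/= -> mn]]; first by left.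
  by right.
by apply: countableU; apply: countableX => //; exact: Wc.
Qed.

(** * Heights of nodes *)

Lemma tree_ind d (T : bPOrderType d) (P : T -> Prop) :
  is_tree T -> (forall t, (forall s, (s < t)%O -> P s) -> P t) -> forall t, P t.
Proof.
move=> treeT Pind t; apply: contrapT => nPt.
have [s st nPs] : exists2 s, (s < t)%O & ~ P s.
  apply: contrapT => ns; apply: nPt; apply: Pind => s st; apply: contrapT => nPs.
  by apply: ns; exists s.
have [||m [[Am lbm] _]] := treeT t (mem [set r | (r < t)%O /\ ~ P r]).
- by move=> r; rewrite !inE => -[].
- by exists s; apply: mem_set.
move: Am => /set_mem[mt nPm]; apply: nPm; apply: Pind => r rm.
apply: contrapT => nPr; have := lbm r.
rewrite inE => /(_ (conj (lt_trans rm mt) nPr)) mr.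
by have := lt_le_trans rm mr; rewrite ltxx.
Qed.

Lemma tree_lt_total d (T : bPOrderType d) (r s t : T) :
  is_tree T -> (r < t)%O -> (s < t)%O -> (r < s)%O || (s <= r)%O.
Proof.
move=> treeT rt st; have := wo_chainW (treeT t).
move=> /(_ r s); rewrite !inE => /(_ rt st) /orP[|->]; last by rewrite orbT.
by rewrite le_eqVlt => /orP[/eqP -> | ->//]; rewrite lexx orbT.
Qed.

Lemma order_iso_restrict d1 d2 (W : orderType d1) (T : porderType d2)
    (f : T -> W) (s t : T) (a : W) :
  set_bij (down t) (down a) f -> {in down t &, {mono f : x y / (x < y)%O}} ->
  (s < t)%O -> order_iso (down s) (down (f s)).
Proof.
move=> [fmap finj fsurj] fmono st.
have dn r : down s r -> r \in down t by move=> rs; rewrite inE; exact: lt_trans rs st.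
have tn : s \in down t by rewrite inE.
exists f; last by move=> x y /set_mem/dn xt /set_mem/dn yt; exact: fmono.
split.
- by move=> r rs; rewrite /down/= fmono// dn.
- by move=> x y /set_mem/dn xt /set_mem/dn yt; exact: finj.
- move=> b bs; have [r rt rb] := fsurj b (lt_trans bs (fmap s st)).
  by exists r => //; rewrite /down/= -fmono ?inE// rb.
Qed.

(** By induction two isomorphisms agree at every [s < t], as both restrict to witnesses for the
    height of [s]; hence their images coincide. *)
Lemma has_height_unique d1 d2 (W : orderType d1) (T : bPOrderType d2)
    (t : T) (a b : W) :
  is_tree T -> has_height t a -> has_height t b -> a = b.
Proof.
move=> treeT; move: t a b; apply: (tree_ind treeT) => t IH a b [f fbij fmono] [g gbij gmono].
have fg s : (s < t)%O -> f s = g s.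
  move=> st; apply: (IH s st); first exact: order_iso_restrict fbij fmono st.
  exact: order_iso_restrict gbij gmono st.
have [fmap _ fsurj] := fbij; have [gmap _ gsurj] := gbij.
case: (ltgtP a b) => // [/gsurj | /fsurj] [s st sE].
  by have := fmap s st; rewrite /down/= fg// sE ltxx.
by have := gmap s st; rewrite /down/= -fg// sE ltxx.
Qed.

(** By induction the heights of the predecessors of [t] form an initial segment of [W], proper
    because [down t] is not of type omega_1; the least missing element is the height of [t]. *)
Lemma has_height_exists d1 d2 (W : orderType d1) (T : bPOrderType d2) (t : T) :
  is_omega1 W -> is_tree T -> (forall t : T, ~ order_iso (down t) [set: W]) ->
  exists a : W, has_height t a.
Proof.
move=> W1 treeT nW; move: t; apply: (tree_ind treeT) => t IH.
have [wo _ _] := W1; have [w0 _] := omega1_bound W1 (@countable0 W).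
have /choice[g gP] s : exists a : W, (s < t)%O -> has_height s a.
  by have [/IH[a sa]|nst] := pselect (s < t)%O; [exists a | exists w0].
have ghomo r s : (r < s)%O -> (s < t)%O -> (g r < g s)%O.
  move=> rs st; have [f fbij fmono] := gP s st; have [fmap _ _] := fbij.
  rewrite (has_height_unique treeT (gP r (lt_trans rs st)) (order_iso_restrict fbij fmono rs)).
  exact: fmap.
have gmono : {in down t &, {mono g : x y / (x < y)%O}}.
  move=> r s; rewrite !inE => rt st; apply/idP/idP; last by move=> rs; exact: ghomo.
  have /orP[//|] := tree_lt_total treeT rt st.
  by rewrite le_eqVlt => /orP[/eqP ->|/ghomo-/(_ rt)/lt_trans /[apply]]; rewrite ltxx.
have ginj : {in down t &, injective g}.
  move=> r s rt st grs; have := gmono r s rt st; have := gmono s r st rt.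
  rewrite grs ltxx => sr rs; rewrite !inE in rt st.
  have := tree_lt_total treeT rt st; rewrite -rs/= le_eqVlt -sr orbF.
  by move/eqP.
have ginit b s : (b < g s)%O -> (s < t)%O -> exists2 r, (r < t)%O & g r = b.
  move=> bs st; have [f fbij fmono] := gP s st; have [_ _ fsurj] := fbij.
  have [r rs rb] := fsurj b bs; exists r; first exact: lt_trans rs st.
  rewrite -rb; apply: (has_height_unique treeT (gP r (lt_trans rs st))).
  exact: order_iso_restrict fbij fmono rs.
have [gsurj|nsurj] := pselect (forall b, exists2 s, (s < t)%O & g s = b).
  by case: (nW t); exists g => //; split=> // b _; have [s st sb] := gsurj b; exists s.
have [|a na amin] := @well_order_min _ W [set b | ~ exists2 s, (s < t)%O & g s = b] wo.
  by move/existsNP: nsurj.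
exists a, g => //; split=> //.
- move=> s st; rewrite /down/= ltNge le_eqVlt; apply/negP => /orP[/eqP as_|as_].
    by apply: na; exists s.
  exact: na (ginit _ _ as_ st).
- move=> b ba; apply: contrapT => nb; have /amin : ~ exists2 s, (s < t)%O & g s = b.
    by move=> [s st sb]; apply: nb; exists s.
  by rewrite leNgt ba.
Qed.

(** Collects what the later arguments use about heights, so that they need not handle order
    isomorphisms. *)
Definition height_map d1 d2 (W : orderType d1) (T : bPOrderType d2)
    (ht : T -> W) : Prop :=
  [/\ {homo ht : s t / (s < t)%O},
      forall t a, (a < ht t)%O -> exists2 s, (s < t)%O & ht s = a,
      forall a, exists t, ht t = a,
      forall a, countable [set t | ht t = a] &
      forall t a, has_height t a <-> ht t = a].

Lemma height_map_exists d1 d2 (W : orderType d1) (T : bPOrderType d2) :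
  is_omega1 W -> omega1_tree W T -> exists ht : T -> W, height_map ht.
Proof.
move=> W1 [treeT [lev nW] levc].
have /choice[ht htP] t := has_height_exists t W1 treeT nW.
have htE t a : has_height t a <-> ht t = a.
  by split=> [ta|<-//]; apply: has_height_unique treeT (htP t) ta.
exists ht; split=> //.
- move=> s t st; have [f fbij fmono] := htP t; have [fmap _ _] := fbij.
  by have /htE -> := order_iso_restrict fbij fmono st; exact: fmap.
- move=> t a at_; have [f fbij fmono] := htP t; have [_ _ fsurj] := fbij.
  have [s st sa] := fsurj a at_; exists s => //.
  by apply/htE; rewrite -sa; exact: order_iso_restrict fbij fmono st.
- by move=> a; have [t /htE ta] := lev a; exists t.
- move=> a; have := levc a; congr countable.
  by apply/seteqP; split=> t /htE.
Qed.

Lemma height_map_index d1 d2 (W : orderType d1) (T : bPOrderType d2)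
    (ht : T -> W) :
  height_map ht ->
  exists idx : T -> nat, forall s t, ht s = ht t -> idx s = idx t -> s = t.
Proof.
move=> [_ _ _ levc _].
have /choice[f fP] a := countable_injP _ (levc a).
exists (fun t => f (ht t) t) => s t st fst; apply: (fP (ht t)).
- by rewrite inE.
- by rewrite inE.
- by rewrite -{1}st.
Qed.

(** * The ideal of the tree *)

Lemma countable_special d (T : porderType d) (U : set T) :
  countable U -> special U.
Proof.
move=> Uc; exists [set [set x] | x in U]; first split.
- exact: sub_countable (card_image_le _ _) Uc.
- by move=> _ [x _ <-] s t /= -> ->; rewrite eqxx.
- apply/seteqP; split=> [x Ux|x [_ [y Uy <-]] /= ->//].
  by exists [set x] => //; exists x.
Qed.

(** A non-root node [t] of such a height has some [s < t] with [ht t <= h (ht s)]. Sending [t] to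
    [s] is regressive, and each fibre meets only countably many levels, so it is countable and hence
    special. *)
Lemma NS_tree_off_closure_points d1 d2 (W : orderType d1) (T : bPOrderType d2)
    (ht : T -> W) (h : W -> W) (B : set T) :
  is_omega1 W -> height_map ht ->
  (forall t, B t -> ~ closure_points h (ht t)) -> NS_tree B.
Proof.
move=> W1 [hlt hsurj _ levc _] Bh.
have /choice[f fP] t : exists s, ~ closure_points h (ht t) ->
    (t != \bot%O -> (s < t)%O) /\ (t = \bot%O \/ (ht t <= h (ht s))%O).
  have [->|t0] := eqVneq t \bot%O; first by exists \bot%O => _; split; [|left].
  have [ct|nct] := pselect (closure_points h (ht t)); first by exists t => /(_ ct).
  suff [s st hst] : exists2 s, (s < t)%O & (ht t <= h (ht s))%O.
    by exists s => _; split=> // ; right.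
  apply: contrapT => ns; apply: nct; split.
    by exists (ht \bot%O); apply: hlt; rewrite lt0x.
  move=> b /hsurj[s st <-]; rewrite ltNge; apply/negP => ts.
  by apply: ns; exists s.
exists f; first by move=> t /Bh nt; exact: (fP t nt).1.
move=> s; apply: countable_special.
apply: (@sub_countable _ _ _ ([set \bot%O] `|`
  \bigcup_(b in [set b | (b <= h (ht s))%O]) [set t | ht t = b])).
  apply: subset_card_le => t [/Bh/fP[_ []]]; first by left.
  by move=> tfs fts; right; exists (ht t) => //=; rewrite -fts.
apply: countableU => //; apply: bigcup_countable => //.
exact: omega1_countable_le.
Qed.

(** Pressing down on an almost-Suslin tree: node [t] lies in the antichain
    [A] of the cover of [f @^-1` [set f t]], and the heights of [A] avoid a club
    indexed by [ht (f t) < ht t]. *)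
Lemma NS_tree_avoids_closure_points d1 d2 (W : orderType d1)
    (T : bPOrderType d2) (ht : T -> W) (B : set T) :
  is_omega1 W -> almost_Suslin W T -> height_map ht -> NS_tree B ->
  exists h, forall t, closure_points h (ht t) -> ~ B t.
Proof.
move=> W1 [_ aS] [hlt hsurj _ levc htE] [f freg fspec].
have /choice[F FP] t : exists F : set (set T),
    [/\ countable F, forall A, F A -> antichain A &
      B `&` f @^-1` [set t] = \bigcup_(A in F) A].
  by have [F [Fc FA] FE] := fspec t; exists F.
have /choice[cl clP] (A : set T) : exists C : set W, antichain A ->
    club C /\ forall t, A t -> ~ C (ht t).
  have [/[dup] anA /aS/not_stationary[C Cclub CA]|nA] := pselect (antichain A).
    exists C => _; split=> // t At /CA; apply; exists t => //; exact/htE.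
  by exists setT.
(* Index [b] carries the clubs of all antichains covering the fibres over nodes of height [b]:
   countably many, as levels are countable. *)
have [||h hP] := @diagonal_closure_points _ W
    (fun b => cl @` (\bigcup_(t in [set t | ht t = b]) F t)) W1.
- move=> b; apply: sub_countable (card_image_le _ _) _.
  by apply: bigcup_countable => // t _; have [] := FP t.
- move=> b C [A [t _ FA] <-]; have [_ anF _] := FP t.
  exact: (clP A (anF A FA)).1.
exists h => t /[dup] ct [[b /hsurj[s st _]] _] Bt.
(* A closure point has elements below it, so [t] is not the root and [f] is regressive there. *)
have ft : (f t < t)%O by apply: freg => //; rewrite -lt0x (le_lt_trans (le0x s) st).
have [_ FA FE] := FP (f t).
have [A FA_ At] : (\bigcup_(A in F (f t)) A) t by rewrite -FE.
apply: ((clP A (FA _ FA_)).2 t At).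
apply: (hP _ ct (ht (f t))); first exact: hlt.
by exists A => //; exists (f t).
Qed.

(** * The two implications *)

Lemma diamond_tree_of_diamond d1 d2 (W : orderType d1) (T : bPOrderType d2)
    (ht : T -> W) :
  is_omega1 W -> almost_Suslin W T -> height_map ht ->
  diamond W -> diamond_tree T.
Proof.
move=> W1 aS hm [D [_ Dguess]]; have [hlt hsurj hex levc _] := hm.
have [idx idxP] := height_map_index hm; have [g ginj] := omega1_pairing W1.
pose e t := g (ht t, idx t).
have einj : injective e by move=> s t /ginj[]; exact: idxP.
exists (fun t => [set s | (s < t)%O /\ D (ht t) (e s)]); split; first by move=> t s [].
move=> X /(NS_tree_avoids_closure_points W1 aS hm)[h hP].
have /choice[k kP] b : exists c, forall s, ht s = b -> (e s < c)%O.
  have [|c cP] := @omega1_bound _ W (e @` [set s | ht s = b]) W1.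
    exact: sub_countable (card_image_le _ _) (levc b).
  by exists c => s sb; apply: cP; exists s.
have [a [/= guess ca]] := Dguess (e @` X) _
  (club_closure_points (fun x => Order.max (h x) (k x)) W1).
have [ha [_ ka]] := closure_points_max ca; have [t ta] := hex a.
rewrite -{}ta in guess ha ka.
have es s : (s < t)%O -> (e s < ht t)%O.
  by move=> /hlt st; apply: lt_trans (ka _ st); exact: kP.
apply: (hP t ha); apply/seteqP; split=> s /=.
  by move=> [Xs st]; split=> //; rewrite -guess; split; [exists s | exact: es].
by rewrite -guess => -[st [[r Xr /einj rs] _]]; rewrite -rs in st *.
Qed.

(** Kunen's argument: were each [E n] to fail at some [X n], the set of nodes
    whose height codes a pair [(b, n)] with [b] in [X n] could not be guessed. *)
Lemma diamond_of_diamond_tree d1 d2 (W : orderType d1) (T : bPOrderType d2)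
    (ht : T -> W) :
  is_omega1 W -> height_map ht -> diamond_tree T -> diamond W.
Proof.
move=> W1 hm [D [_ Dguess]]; have [hlt hsurj hex levc _] := hm.
have [idx idxP] := height_map_index hm; have [g ginj] := omega1_pairing W1.
(* The [n]-th guess at [a] is decoded from [D t] for the node [t] of height [a] and index [n]; it is
   empty if there is no such node. *)
pose E n a : set W := [set b | (b < a)%O /\
  exists t s, [/\ ht t = a, idx t = n, D t s & ht s = g (b, n)]].
suff [n En] : exists n, forall X, stationary [set a | X `&` down a = E n a].
  by exists (E n); split=> // a b [].
apply: contrapT => /forallNP nE.
have /choice[X XP] n : exists X, ~ stationary [set a | X `&` down a = E n a].
  exact/existsNP/nE.
have /choice[C CP] n : exists C, club C /\
    forall a, C a -> ~ (X n `&` down a = E n a).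
  by have [C clubC CX] := not_stationary (XP n); exists C.
(* With a constant family, the diagonal intersection puts the closure points in every [C n] at
   once. *)
have [||h hP] := @diagonal_closure_points _ W (fun _ => range C) W1.
- by move=> _; exact: sub_countable (card_image_le _ _) _.
- by move=> _ _ [n _ <-]; exact: (CP n).1.
have /choice[k kP] b : exists c, forall n, (g (b, n) < c)%O.
  have [|c cP] := @omega1_bound _ W (range (fun n => g (b, n))) W1.
    exact: sub_countable (card_image_le _ _) _.
  by exists c => n; apply: cP; exists n.
pose Y : set T := [set t | exists b n, ht t = g (b, n) /\ X n b].
(* Otherwise all correct guesses would sit at heights off the closure points, and their set would be
   in the ideal. *)
have [t Yt ct] : exists2 t, Y `&` down t = D t &
    closure_points (fun x => Order.max (h x) (k x)) (ht t).
  apply: contrapT => nt; apply: (Dguess Y).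
  apply: (NS_tree_off_closure_points W1 hm) => t Yt ct.
  by apply: nt; exists t; last exact: ct.
have [ha [_ ka]] := closure_points_max ct.
(* Only now is [n] fixed: [Y] codes all the sets [X n] simultaneously, so whichever index [t] has,
   [E n] is correct at [ht t], which lies in [C n]. *)
pose n := idx t; have [[b0 b0t] _] := ha.
have Ct : C n (ht t) by apply: (hP _ ha b0) => //; exists n.
apply: ((CP n).2 _ Ct); apply/seteqP; split=> b /=.
  move=> [Xb bt]; split=> //; have gt : (g (b, n) < ht t)%O.
    exact: lt_trans (kP b n) (ka b bt).
  have [s st sg] := hsurj _ _ gt; exists t, s; split=> //.
  by rewrite -Yt; split=> //; exists b, n.
move=> [bt [t' [s [t't nt' Dts sg]]]]; split=> //.
(* Height and index force [t'] to be [t], and injectivity of [g] recovers [b] and [n] from the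
   height of [s]. *)
move: Dts; rewrite (idxP _ _ t't nt') -Yt => -[[b' [n' []]]].
by rewrite sg => /ginj[<- <-].
Qed.

Theorem theorem4p13 (d1 d2 : Order.disp_t) (W : orderType d1)
    (T : bPOrderType d2) (hW : is_omega1 W) (hT : almost_Suslin W T) :
  diamond_tree T <-> diamond W.
Proof.
have [ht hm] := height_map_exists hW hT.1; split.
  exact: diamond_of_diamond_tree hW hm.
exact: diamond_tree_of_diamond hW hT hm.
Qed.
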